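(* For every integer $d\ge 2$, the number $c_d$ of combinatorial classes of the space $\Xi_d$ of monic and centered complex polynomial vector fields of degree $d$ is $$c_d={}_2F_1\bigl([2-2d,\,1-d];[2];2\bigr).$$
   Context: Let $d\ge 2$. $\Xi_d\simeq\mathbb{C}^{d-1}$ is the space of vector fields $\xi_P=P(z)\frac{d}{dz}$ on $\mathbb{C}$ with $P(z)=z^d+a_{d-2}z^{d-2}+\dots+a_0$ a monic centered complex polynomial; trajectories are solutions of $\dot z=P(z)$ in real time. Separatrices. The point $\infty$ is a pole of order $d-2$ of $\xi_P$, and there are $2d-2$ trajectory directions at $\infty$, with asymptotic angles $\frac{2\pi\ell}{2d-2}$, $\ell\in\mathbb{Z}/(2d-2)$; those with $\ell$ even are incoming to $\infty$, those with $\ell$ odd are outgoing from $\infty$. The separatrix $s_\ell$ is the maximal trajectory with asymptotic direction $\ell$ at $\infty$. Every separatrix is either landing (its other end tends to an equilibrium point) or homoclinic (it joins $\infty$ to $\infty$); a homoclinic separatrix is written $s_{k,j}$, where $k$ odd and $j$ even are its two asymptotic directions. The end $e_\ell$ is $\infty$ with access between $s_{\ell-1}$ and $s_\ell$. The zones of $\xi_P$ are the connected components of $\mathbb{C}$ minus the closure of the union of all separatrices; an $\alpha\omega$-zone is a zone all of whose trajectories have the same $\alpha$-limit equilibrium point and the same $\omega$-limit equilibrium point, these two points being distinct. Each $\alpha\omega$-zone has on its boundary exactly one odd end $e_k$ and exactly one even end $e_j$ such that $s_k$ and $s_j$ are landing; the distinguished transversal $T_{k,j}$ of the zone joins these two ends.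 Combinatorial data. A combinatorial data set $(\iota,H,T)$ of degree $d$ consists of an involution $\iota$ of $\mathbb{Z}/(2d-2)$ and disjoint subsets $H,T\subset\mathbb{Z}/(2d-2)$ with $H\cup T=\{\ell:\iota(\ell)\neq\ell\}$ such that: (i) if $\iota(\ell)\ne\ell$ then $\ell$ and $\iota(\ell)$ have different parity; (ii) $\iota$ is non-crossing, i.e. the pairs $\{\ell,\iota(\ell)\}$ with $\iota(\ell)\ne \ell$ are pairwise non-crossing when $\mathbb{Z}/(2d-2)$ is placed in cyclic order on a circle; (iii) if $\iota(\ell)\neq\ell$, then $\ell,\iota(\ell)$ are both in $H$ or both in $T$. The data set of $\xi_P$ has as pairs in $H$ the $\{k,j\}$ for the homoclinic separatrices $s_{k,j}$, as pairs in $T$ the $\{k,j\}$ for the distinguished transversals $T_{k,j}$, and all other indices fixed by $\iota$. A combinatorial class in $\Xi_d$ is the set of all vector fields in $\Xi_d$ with a given combinatorial data set. It is known that every combinatorial data set of degree $d$ is realized by some $\xi_P\in\Xi_d$. So $c_d$, the total number of combinatorial classes in $\Xi_d$, is the number of combinatorial data sets of degree $d$. Hypergeometric notation: ${}_2F_1([a,b];[c];z)=\sum_{n\ge0}\frac{(a)_n(b)_n}{(c)_n}\frac{z^n}{n!}$ with $(x)_n=x(x+1)\cdots(x+n-1)$, $(x)_0=1$; here the sum is finite because $1-d$ is a non-positive integer. *)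

(* Defs.v *)
From HB Require Import structures.
From mathcomp Require Import all_boot all_order all_algebra.
From mathcomp Require Import complex.
From mathcomp Require Import all_classical all_reals all_analysis.
Set Implicit Arguments.
Unset Strict Implicit.
Unset Printing Implicit Defensive.
Import Order.TTheory GRing.Theory Num.Theory numFieldNormedType.Exports.
Local Open Scope classical_set_scope.
Local Open Scope complex_scope.
Local Open Scope ring_scope.

(* Meaningful for d >= 2 only: 'Z_n is Z/n when n >= 2. *)
Definition dirs (d : nat) : finType := 'Z_(2 * d - 2).

Definition dir_val d (l : dirs d) : nat := (l : 'Z_(2 * d - 2)).

Definition parity_odd d (l : dirs d) : bool := odd (dir_val l).

Definition comb_triple (d : nat) : finType :=
  ({ffun dirs d -> dirs d} * {set dirs d} * {set dirs d})%type.

(* Two chords of the circle cross iff their endpoints interlace, which may be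
   tested on the representatives 0, ..., 2d-3 in their usual order. *)
Definition noncrossing d (i : {ffun dirs d -> dirs d}) : bool :=
  [forall a, forall b, ~~ [&& dir_val a < dir_val b,
     dir_val b < dir_val (i a) & dir_val (i a) < dir_val (i b)]%N].

Definition comb_data (d : nat) : {pred comb_triple d} :=
  [pred D : comb_triple d | let: (i, H, T) := D in
    [&& [forall l, i (i l) == l],
        [disjoint H & T],
        [forall l, ((l \in H) || (l \in T)) == (i l != l)],
        [forall l, (i l != l) ==> (parity_odd l != parity_odd (i l))],
        noncrossing i
      & [forall l, (i l != l) ==>
           ((l \in H) && (i l \in H)) || ((l \in T) && (i l \in T))]]].

Arguments comb_data d : clear implicits.

Section VectorFields.
Variables (R : realType) (d : nat).

(* The complex plane with its metric topology. *)
Let C : normedModType R[i] := R[i]^o.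

(* The vector field P(z) d/dz is identified with P. *)
Definition Xi : set {poly R[i]} :=
  [set P | [/\ P \is monic, size P = d.+1 & P`_d.-1 = 0]].

Implicit Types (P : {poly R[i]}) (a b : \bar R) (z : R -> C) (l k j : dirs d).

(* z solves dz/dt = P(z) on the open time interval ]a, b[; the values of z
   outside of ]a, b[ are irrelevant. *)
Definition trajectory P a b z : Prop :=
  (a < b)%E /\
  forall t : R, (a < t%:E < b)%E ->
    (fun h : R => (h^-1)%:C *: (z (t + h) - z t)) @ 0^' --> (P.[z t] : C).

Definition max_trajectory P a b z : Prop :=
  trajectory P a b z /\
  forall a' b' z', trajectory P a' b' z' -> (a' <= a)%E -> (b <= b')%E ->
    (forall t : R, (a < t%:E < b)%E -> z' t = z t) -> a' = a /\ b' = b.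

Definition start_of a : set_system R := if a is r%:E then r^'+ else -oo%R.
Definition finish_of b : set_system R := if b is r%:E then r^'- else +oo%R.

Definition cis (theta : R) : C := (cos theta +i* sin theta)%C.

Definition angle (x : R) : R := 2 * pi * x / (2 * d - 2)%:R.

Definition to_infinity (F : set_system R) z l : Prop :=
  (fun t => complex.Re `|z t|) @ F --> +oo /\
  (fun t => z t / `|z t| : C) @ F --> cis (angle (dir_val l)%:R).

(* Even directions are reached in forward time (incoming to infinity), odd
   ones in backward time (outgoing from infinity). *)
Definition inf_side a b l : set_system R :=
  if parity_odd l then start_of a else finish_of b.
Definition other_side a b l : set_system R :=
  if parity_odd l then finish_of b else start_of a.

(* (a, b, z) parametrizes the separatrix s_l (uniquely up to a translation of
   time and up to the values of z outside of ]a, b[). *)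
Definition is_separatrix P l a b z : Prop :=
  max_trajectory P a b z /\ to_infinity (inf_side a b l) z l.

Definition separatrices P : set C :=
  [set w | exists l a b z, is_separatrix P l a b z /\
     exists2 t : R, (a < t%:E < b)%E & z t = w].

Definition landing P l : Prop :=
  exists a b z, is_separatrix P l a b z /\
    exists2 w : C, root P w & z @ other_side a b l --> w.

Definition homoclinic P k j : Prop :=
  [/\ parity_odd k, ~~ parity_odd j &
      exists a b z, is_separatrix P k a b z /\ is_separatrix P j a b z].

Definition zone P (Z : set C) : Prop :=
  exists2 w, (~` closure (separatrices P)) w &
    Z = connected_component (~` closure (separatrices P)) w.

Definition alpha_omega_zone P (Z : set C) : Prop :=
  zone P Z /\
  exists al om : C, [/\ root P al, root P om, al != om &
    forall a b z, max_trajectory P a b z ->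
      (exists2 t : R, (a < t%:E < b)%E & Z (z t)) ->
      z @ start_of a --> al /\ z @ finish_of b --> om].

(* The end e_l is on the boundary of Z: Z gives access to infinity between the
   directions of s_(l-1) and s_l, i.e. it contains the far part of every ray
   with argument strictly between the two asymptotic angles. *)
Definition boundary_end (Z : set C) l : Prop :=
  forall theta : R,
    angle ((dir_val l)%:R - 1) < theta < angle (dir_val l)%:R ->
    \forall r \near +oo%R, Z ((r : R)%:C *: cis theta).

(* The zone joined by the distinguished transversal T_(k,j) exists. *)
Definition dist_transversal P k j : Prop :=
  [/\ parity_odd k, ~~ parity_odd j, landing P k, landing P j &
      exists Z, [/\ alpha_omega_zone P Z, boundary_end Z k & boundary_end Z j]].

(* D is the data set of xi_P.  Both parities of the members of a pair being
   prescribed, it is enough to describe the pairs from their odd member; that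
   the remaining indices are fixed is part of comb_data. *)
Definition has_data P (D : comb_triple d) : Prop :=
  let: (i, H, T) := D in
  [/\ D \in comb_data d,
      forall k j, parity_odd k -> ~~ parity_odd j ->
        (k \in H /\ i k = j) <-> homoclinic P k j &
      forall k j, parity_odd k -> ~~ parity_odd j ->
        (k \in T /\ i k = j) <-> dist_transversal P k j].

Definition comb_class (D : comb_triple d) : set {poly R[i]} :=
  [set P | Xi P /\ has_data P D].

Definition comb_classes : set (set {poly R[i]}) :=
  [set K | K !=set0 /\ exists2 D, D \in comb_data d & K = comb_class D].

Definition all_data_realized : Prop :=
  forall D, D \in comb_data d -> exists P, Xi P /\ has_data P D.

End VectorFields.

Arguments comb_classes R d : clear implicits.
Arguments all_data_realized R d : clear implicits.

Section Hypergeometric.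
Variable R : realType.

Definition pochhammer (x : R) (n : nat) : R := \prod_(i < n) (x + i%:R).

Definition hyp2F1_term (a b c z : R) : R^nat := fun n =>
  pochhammer a n * pochhammer b n / pochhammer c n * (z ^+ n / n`!%:R).

Definition hyp2F1 (a b c z : R) : R := lim (series (hyp2F1_term a b c z) @ \oo).

End Hypergeometric.

(* Main.v *)
(* Forgetting the geometry, a data set is a non-crossing partial matching of
   2d-2 cyclically ordered points into pairs of opposite parity, each pair
   having one of two colours.  Decomposing such a matching of N+1 points in a
   row according to the partner of the first one gives
     f(N+1) = f(N) + 2 sum_(k < N, k even) f(k) f(N-1-k),
   that is, E = 1 + X O + 2 X E^2 and O = E + 2 X E O for the even and odd parts
   E = sum f(2m) X^m and O = sum f(2m+1) X^m.  Multiplied by E^r these become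
   linear recurrences for the coefficients of E^r and E^r O, which are solved by
   closed sums; for E^1 the sum is the hypergeometric one.  Finally, a vector
   field determines its data set, so realized data sets and classes are in
   bijection. *)
Require Import Defs.
From mathcomp Require Import all_boot all_order all_algebra.
From mathcomp Require Import all_classical all_reals all_analysis.
From mathcomp Require Import ring lra zify.

(** * Counting coloured non-crossing diagrams on an interval of points *)

Section Chords.
Context {K : nat}.
Implicit Types (f g h : {ffun 'I_K -> 'I_K * bool}) (l p q : 'I_K).

(* [f l] is the partner of [l] (itself if [l] is unpaired) with the colour of
   the pair: [true] for H, [false] for T; unpaired points have colour [false]. *)
Definition chord_diagram f : bool :=
  [&& [forall l : 'I_K, f (f l).1 == (l, (f l).2)],
      [forall l : 'I_K, ((f l).1 == l) ==> ~~ (f l).2],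
      [forall l : 'I_K, ((f l).1 != l) ==> (odd l != odd (f l).1)]
    & [forall l : 'I_K, forall q : 'I_K, ~~ [&& l < q, q < (f l).1 & (f l).1 < (f q).1]]].

Lemma chord_diagramP f : reflect
  [/\ forall l, f (f l).1 = (l, (f l).2),
      forall l, (f l).1 = l -> (f l).2 = false,
      forall l, (f l).1 != l -> odd l != odd (f l).1
    & forall l q, l < q -> q < (f l).1 -> (f q).1 <= (f l).1]
  (chord_diagram f).
Proof.
apply: (iffP and4P) => -[h1 h2 h3 h4]; split.
- by move=> l; apply/eqP/(forallP h1).
- by move=> l /eqP fl; apply/negbTE/(implyP (forallP h2 l)).
- by move=> l; apply/implyP/(forallP h3).
- by move=> l q lq ql; have /forallP/(_ q) := forallP h4 l; rewrite lq ql/= -leqNgt.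
- by apply/forallP => l; rewrite h1.
- by apply/forallP => l; apply/implyP => /eqP/h2 ->.
- by apply/forallP => l; apply/implyP/h3.
- apply/forallP => l; apply/forallP => q; apply/and3P => -[lq ql].
  by rewrite ltnNge h4.
Qed.

(** Diagrams on an interval stay functions on all [K] points, trivial outside it. All intervals thus
    share one type, and cutting or gluing needs no relabelling. *)
Definition diagrams_in (a b : nat) : {set {ffun 'I_K -> 'I_K * bool}} :=
  [set f | chord_diagram f &&
    [forall l : 'I_K, ((l < a) || (b <= l)) ==> (f l == (l, false))]].

Lemma diagrams_inP a b f : reflect
  (chord_diagram f /\ forall l, (l < a) || (b <= l) -> f l = (l, false))
  (f \in diagrams_in a b).
Proof.
rewrite inE; apply: (iffP andP) => -[hf h]; split=> //.
  by move=> l hl; apply/eqP/(implyP (forallP h l)).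
by apply/forallP => l; apply/implyP => /h ->.
Qed.

Lemma diagrams_in_stable a b f l :
  f \in diagrams_in a b -> a <= l < b -> a <= (f l).1 < b.
Proof.
move=> /diagrams_inP[/chord_diagramP[h1 _ _ _] hf] lab.
apply/negPn/negP => nab; have := h1 l.
by rewrite hf; [case=> fl; rewrite fl lab in nab|lia].
Qed.

Lemma diagrams_in_nil a : #|diagrams_in a a| = 1.
Proof.
apply/eqP/cards1P; exists [ffun l => (l, false)]; apply/setP => f.
rewrite finset.in_set1; apply/idP/eqP => [/diagrams_inP[_ h]|->].
  by apply/ffunP => l; rewrite ffunE h; last lia.
apply/diagrams_inP; split=> [|l]; last by rewrite ffunE.
by apply/chord_diagramP; split=> l; rewrite ?ffunE ?eqxx//= => q; rewrite ffunE/=; lia.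
Qed.

Definition restrict_diagram (a b : nat) f : {ffun 'I_K -> 'I_K * bool} :=
  [ffun l : 'I_K => if a <= l < b then f l else (l, false)].

Lemma restrict_diagram_in a b f : chord_diagram f ->
  (forall l, a <= l < b -> a <= (f l).1 < b) ->
  restrict_diagram a b f \in diagrams_in a b.
Proof.
move=> /chord_diagramP[h1 h2 h3 h4] st.
apply/diagrams_inP; split; last first.
  by move=> l hl; rewrite ffunE ifN//; lia.
apply/chord_diagramP; split.
- move=> l; rewrite !ffunE; have [lab|/negbTE lab] := boolP (a <= l < b).
    by rewrite st.
  by rewrite /= lab.
- by move=> l; rewrite ffunE; case: ifP => // _; apply: h2.
- by move=> l; rewrite ffunE; case: ifP => [_|_ /=]; [apply: h3|rewrite eqxx].
- move=> l q; rewrite !ffunE; case: ifP => [lab|_ /=]; last by lia.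
  case: ifP => [_|qab]; first exact: h4.
  by have := st _ lab; lia.
Qed.

Section Join.
Variables (a b : nat) (s p : 'I_K) (c : bool).
Hypotheses (sa : s = a :> nat) (ap : a < p) (pb : p < b) (odd_ap : odd a != odd p).

Definition join_diagrams g h : {ffun 'I_K -> 'I_K * bool} :=
  [ffun l : 'I_K => if l == s then (p, c) else if l == p then (s, c)
                    else if l < p then g l else h l].

Lemma join_in g h : g \in diagrams_in a.+1 p -> h \in diagrams_in p.+1 b ->
  join_diagrams g h \in [set f in diagrams_in a b | f s == (p, c)].
Proof.
move=> gS hS.
have gst l : l < p -> l != s -> ((g l).1 < p) && ((g l).1 != s).
  move=> lp ls; have [al|la] := leqP a.+1 l.
    have := diagrams_in_stable _ _ _ l gS; rewrite al lp => /(_ isT).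
    by rewrite -(inj_eq val_inj)/=; lia.
  by have /diagrams_inP[_ ->//=] := gS; rewrite ?lp ?ls// la.
have hst l : p < l -> p < (h l).1.
  move=> pl; have [lb|bl] := ltnP l b.
    by have := diagrams_in_stable _ _ _ l hS; rewrite pl lb => /(_ isT); lia.
  by have /diagrams_inP[_ ->//=] := hS; rewrite bl orbT.
have /diagrams_inP[/chord_diagramP[g1 g2 g3 g4] g0] := gS.
have /diagrams_inP[/chord_diagramP[h1 h2 h3 h4] h0] := hS.
have sp : s != p by rewrite -(inj_eq val_inj)/=; lia.
have js : join_diagrams g h s = (p, c) by rewrite ffunE eqxx.
have jp : join_diagrams g h p = (s, c) by rewrite ffunE eq_sym (negbTE sp) eqxx.
have jl l : l < p -> l != s -> join_diagrams g h l = g l.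
  by move=> lp ls; rewrite ffunE (negbTE ls) lp ifN// -(inj_eq val_inj)/=; lia.
have jr l : p < l -> join_diagrams g h l = h l.
  by move=> pl; rewrite ffunE !ifN// -?(inj_eq val_inj)/=; lia.
(* Each axiom is checked separately at [s], at [p], on the side of [p] governed by [g], and on the
   side governed by [h]. *)
have cases (P : 'I_K -> Prop) : P s -> P p -> (forall l, l < p -> l != s -> P l) ->
    (forall l, p < l -> P l) -> forall l, P l.
  move=> Ps Pp Pl Pr l; have [lp|pl|/val_inj ->//] := ltngtP l p; last exact: Pr.
  by have [->//|ls] := eqVneq l s; apply: Pl.
rewrite inE js eqxx andbT; apply/diagrams_inP; split; last first.
  apply: cases => [||l lp ls|l pl]; [lia|lia| |].
    by move=> hl; rewrite jl// g0//; lia.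
  by move=> hl; rewrite jr// h0//; lia.
apply/chord_diagramP; split.
- apply: cases => [||l lp ls|l pl]; [by rewrite js jp|by rewrite jp js| |].
    by have /andP[? ?] := gst _ lp ls; rewrite !jl.
  by have := hst _ pl => ?; rewrite !jr.
- apply: cases => [||l lp ls|l pl].
  + by rewrite js => /= e; move: sp; rewrite e eqxx.
  + by rewrite jp => /= e; move: sp; rewrite e eqxx.
  + by rewrite jl//; apply: g2.
  + by rewrite jr//; apply: h2.
- apply: cases => [||l lp ls|l pl].
  + by rewrite js/= sa.
  + by rewrite jp/= sa => _; rewrite eq_sym.
  + by rewrite jl//; apply: g3.
  + by rewrite jr//; apply: h3.
- apply: cases => [||l lp ls|l pl] q.
  + rewrite js/= sa => aq qp; have qs : q != s by rewrite -(inj_eq val_inj)/=; lia.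
    by rewrite jl//; have /andP[/ltnW] := gst q qp qs.
  + by rewrite jp/=; lia.
  + rewrite jl// => lq ql; have /andP[glp _] := gst _ lp ls.
    have [qs|qs] := eqVneq q s; last by rewrite jl ?g4//; lia.
    by move: lq ql; rewrite qs => lq; rewrite g0/=; lia.
  + by rewrite jr// => lq ql; rewrite jr ?h4//; lia.
Qed.

(** No chord crosses the one from [s] to [p], so the points under it are matched among themselves,
    and so are those beyond it. *)
Lemma join_restrict f : f \in diagrams_in a b -> f s = (p, c) ->
  [/\ restrict_diagram a.+1 p f \in diagrams_in a.+1 p,
      restrict_diagram p.+1 b f \in diagrams_in p.+1 b
    & f = join_diagrams (restrict_diagram a.+1 p f) (restrict_diagram p.+1 b f)].
Proof.
move=> fS fs; have /diagrams_inP[cf f0] := fS.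
have /chord_diagramP[h1 h2 h3 h4] := cf.
have fp : f p = (s, c) by have := h1 s; rewrite fs.
(* Non-crossing with the chord at [s] bounds the partner by [p]; the values [s] and [p] are excluded
   because these two are partners of each other. *)
have st1 l : a.+1 <= l < p -> a.+1 <= (f l).1 < p.
  move=> alp; have := diagrams_in_stable _ _ _ l fS.
  have := h1 l; have := h4 s l; rewrite fs/= sa.
  have [->|ns] := eqVneq (f l).1 s.
    by rewrite fs => _ -[pl]; move: alp; rewrite -pl ltnn andbF.
  have [->|np] := eqVneq (f l).1 p.
    by rewrite fp => _ -[sl]; move: alp; rewrite -sl sa ltnn.
  by move: ns np; rewrite -!(inj_eq val_inj)/=; lia.
(* A partner under the chord would, by [st1], have its own partner [l] under the chord. *)
have st2 l : p.+1 <= l < b -> p.+1 <= (f l).1 < b.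
  move=> plb; have := diagrams_in_stable _ _ _ l fS.
  have := h1 l; have := st1 (f l).1.
  have [->|ns] := eqVneq (f l).1 s.
    by rewrite fs => _ -[pl]; move: plb; rewrite -pl ltnn.
  have [->|np] := eqVneq (f l).1 p.
    by rewrite fp => _ -[sl]; move: plb; rewrite -sl sa; lia.
  move: ns np; rewrite -!(inj_eq val_inj)/= => ns np + e; rewrite e/=; lia.
split; [exact: restrict_diagram_in|exact: restrict_diagram_in|].
apply/ffunP => l; rewrite !ffunE.
have [->//|ls] := eqVneq l s; have [->//|lp] := eqVneq l p.
move: ls lp; rewrite -!(inj_eq val_inj)/= sa => ls lp.
by case: ltnP => lp'; case: ifP => // h; apply: f0; lia.
Qed.

Lemma restrict_join g h : g \in diagrams_in a.+1 p -> h \in diagrams_in p.+1 b ->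
  restrict_diagram a.+1 p (join_diagrams g h) = g /\
  restrict_diagram p.+1 b (join_diagrams g h) = h.
Proof.
move=> /diagrams_inP[_ g0] /diagrams_inP[_ h0].
split; apply/ffunP => l; rewrite !ffunE; case: ifP => hl.
- have /andP[al lp] := hl; rewrite lp -!(inj_eq val_inj)/=.
  by rewrite !ifN//; lia.
- by rewrite g0//; lia.
- by rewrite -!(inj_eq val_inj)/= !ifN//; lia.
- by rewrite h0//; lia.
Qed.

Lemma card_join : #|[set f in diagrams_in a b | f s == (p, c)]| =
  #|diagrams_in a.+1 p| * #|diagrams_in p.+1 b|.
Proof.
rewrite -cardsX -(card_in_imset (f := fun u => join_diagrams u.1 u.2)).
  congr #|pred_of_set _|; apply/setP => f; apply/idP/imsetP.
    rewrite inE => /andP[fS /eqP fs]; have [gS hS e] := join_restrict _ fS fs.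
    by exists (restrict_diagram a.+1 p f, restrict_diagram p.+1 b f);
      rewrite // inE gS hS.
  by move=> [[g h] /setXP[/= gS hS] ->]; apply: join_in.
move=> [g h] [g' h'] /setXP[/= gS hS] /setXP[/= gS' hS'] e.
have := restrict_join _ _ gS hS; rewrite e/=.
by have [-> ->] := restrict_join _ _ gS' hS' => -[-> ->].
Qed.

End Join.

Lemma diagrams_in_free a b (s : 'I_K) : s = a :> nat -> a < b ->
  [set f in diagrams_in a b | f s == (s, false)] = diagrams_in a.+1 b.
Proof.
move=> sa ab; apply/setP => f; rewrite inE; apply/andP/diagrams_inP.
  move=> [/diagrams_inP[cf f0] /eqP fs]; split=> // l.
  rewrite ltnS leq_eqVlt -orbA => /orP[/eqP la|]; last exact: f0.
  by have -> : l = s by apply/val_inj; rewrite /= sa.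
move=> [cf f0]; split; last by rewrite f0// sa ltnSn.
by apply/diagrams_inP; split=> // l h; apply: f0; lia.
Qed.

(** An unpaired [s] has colour [false], and a true partner has the other parity; it cannot lie
    outside the interval, where every point is its own partner. *)
Lemma diagrams_in_empty a b (s p : 'I_K) c : s = a :> nat -> (p, c) != (s, false) ->
  ~~ [&& a < p, p < b & odd a != odd p] ->
  [set f in diagrams_in a b | f s == (p, c)] = finset.set0.
Proof.
move=> sa ne np; apply/setP => f; rewrite finset.in_set0 inE; apply/negbTE/negP.
move=> /andP[fS /eqP fs]; have /diagrams_inP[cf f0] := fS.
have /chord_diagramP[h1 h2 h3 h4] := cf.
have ps : p != s.
  apply/eqP => ps; move: ne; rewrite ps xpair_eqE eqxx/=.
  by have := h2 s; rewrite fs/= => ->; rewrite ?eqxx.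
have fp : f p = (s, c) by have := h1 s; rewrite fs.
have := h3 s; rewrite fs/= => /(_ ps); rewrite sa => op.
have : (p < a) || (b <= p).
  by move: ps np; rewrite op -(inj_eq val_inj)/= sa; lia.
by move=> /f0; rewrite fp => -[sp]; rewrite sp eqxx in ps.
Qed.

(** Diagrams are sorted by the value at the first point [s]. The factor 2 counts the colours of its
    chord. *)
Lemma card_diagrams_in_split a b : a < b -> b <= K ->
  #|diagrams_in a b| = #|diagrams_in a.+1 b| +
    2 * \sum_(p < K | [&& a < p, p < b & odd a != odd p])
      #|diagrams_in a.+1 p| * #|diagrams_in p.+1 b|.
Proof.
move=> ab bK; have aK := leq_trans ab bK; pose s := Ordinal aK.
pose part v := #|[set f in diagrams_in a b | f s == v]|.
have -> : #|diagrams_in a b| = \sum_(v : 'I_K * bool) part v.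
  rewrite -sum1_card (partition_big (fun f : {ffun _ -> _} => f s) xpredT)//=.
  by apply: eq_bigr => v _; rewrite /part -sum1_card; apply: eq_bigl => f; rewrite inE.
have -> : \sum_v part v = \sum_(p < K) \sum_c part (p, c).
  by rewrite pair_bigA; apply: eq_bigr => -[].
(* The index [s] is the unpaired case, where only the colour [false] contributes. *)
rewrite (bigD1 s)//= big_bool/= [part (s, true)]/part.
rewrite diagrams_in_empty ?cards0 ?xpair_eqE ?andbF//=; last by rewrite ltnn.
rewrite {1}/part diagrams_in_free//; congr (_ + _).
rewrite big_distrr/= big_mkcond [RHS]big_mkcond; apply: eq_bigr => p _.
rewrite big_bool/= -(inj_eq val_inj)/=; case: ifP => [ps|pa]; last first.
  by rewrite ifN//; lia.
case: ifPn => [/and3P[ap pb op]|np].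
  by rewrite /part !card_join// mul2n addnn.
by rewrite /part !diagrams_in_empty ?cards0// xpair_eqE -(inj_eq val_inj)/= (negbTE ps).
Qed.

Lemma card_diagrams_in_rec a N : a + N.+1 <= K ->
  #|diagrams_in a (a + N.+1)| = #|diagrams_in a.+1 (a.+1 + N)| +
    2 * \sum_(k < N | ~~ odd k)
      #|diagrams_in a.+1 (a.+1 + k)| *
      #|diagrams_in (a.+1 + k).+1 ((a.+1 + k).+1 + (N - k.+1))|.
Proof.
move=> aNK; rewrite card_diagrams_in_split//; last by lia.
rewrite addSnnS; congr (_ + 2 * _).
pose G (p : nat) := #|diagrams_in a.+1 p| * #|diagrams_in p.+1 (a + N.+1)|.
rewrite -(big_mkord (fun p : nat => [&& a < p, p < a + N.+1 & odd a != odd p]) G).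
transitivity (\sum_(a.+1 <= p < a + N.+1 | odd a != odd p) G p).
  rewrite [RHS](big_nat_widen _ _ K)// [RHS](big_nat_widenl _ 0)//.
  by apply: eq_bigl => p; lia.
rewrite -{1}[a.+1]add0n big_addn big_mkord.
rewrite (_ : a + N.+1 - a.+1 = N); last by lia.
(* With [p = k + a.+1], opposite parities of [a] and [p] mean that [k] is even. *)
apply: eq_big => [k|k _]; first by rewrite oddD/=; case: (odd k); case: (odd a).
have kN := ltn_ord k; rewrite /G (addnC k); congr (_ * #|pred_of_set (diagrams_in _ _)|).
lia.
Qed.

(** Although parity is read off absolute positions, the recurrence involves only lengths, so strong
    induction on [N] removes the dependence on [a]. *)
Lemma card_diagrams_in_shift N a : a + N <= K ->
  #|diagrams_in a (a + N)| = #|diagrams_in 0 N|.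
Proof.
elim/ltn_ind: N a => -[|N] IH a aN; first by rewrite addn0 !diagrams_in_nil.
have := card_diagrams_in_rec 0 N; rewrite add0n => ->; last by lia.
rewrite card_diagrams_in_rec//; congr (_ + 2 * _).
  by rewrite !IH//; lia.
by apply: eq_bigr => -[k kN] _ /=; rewrite !IH//; lia.
Qed.

Lemma card_diagramsS N : N < K ->
  #|diagrams_in 0 N.+1| = #|diagrams_in 0 N| +
    2 * \sum_(k < N | ~~ odd k) #|diagrams_in 0 k| * #|diagrams_in 0 (N - k.+1)|.
Proof.
move=> NK; have := card_diagrams_in_rec 0 N; rewrite add0n => ->//.
congr (_ + 2 * _); first by rewrite card_diagrams_in_shift.
by apply: eq_bigr => -[k kN] _ /=; rewrite !card_diagrams_in_shift//; lia.
Qed.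

End Chords.

Import Order.TTheory GRing.Theory Num.Theory numFieldNormedType.Exports.
Local Open Scope classical_set_scope.
Local Open Scope card_scope.
Local Open Scope ring_scope.

(** * Closed sums solving the recurrence *)

Section Closed.
Context {F : realFieldType}.

(* If E and O generate the numbers of diagrams on an even, resp. odd,
   number of points, with each pair weighted by x, then [ucoef r m n] and
   [vcoef r m n] are the coefficients of X^m x^n in E^r and E^r O, as given by
   Lagrange inversion for w = X E, which solves
   w = X (1 + w - x w) / (1 - x w)^2.  [ucoef 0 0 0] is a junk value. *)
Definition ucoef (r m n : nat) : F :=
  r%:R / (m + r)%:R * 'C(m + r, n + r)%:R * 'C((2 * m + r).-1, n)%:R.
Definition vcoef (r m n : nat) : F :=
  (m + r).+1%:R^-1 * 'C((m + r).+1, (n + r).+1)%:R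
  * (r%:R * 'C((2 * m + r).+1, n)%:R + 'C((2 * m + r).+2, n)%:R).

Lemma natr_binS (a n : nat) :
  'C(a.+1, n.+1)%:R = 'C(a, n.+1)%:R + 'C(a, n)%:R :> F.
Proof. by rewrite binS natrD. Qed.

(* Parametrizes two adjacent binomial coefficients by their common factor, so
   that identities between hypergeometric terms become rational ones. *)
Lemma bin_param (a n : nat) : exists2 k : F,
  'C(a, n)%:R = n.+1%:R * k & 'C(a, n.+1)%:R = (a%:R - n%:R) * k.
Proof.
have n0 := ler0n F n.
have h : n.+1%:R * 'C(a.+1, n.+1)%:R = a.+1%:R * 'C(a, n)%:R :> F.
  by rewrite -!natrM mul_bin_diag.
exists ('C(a, n)%:R / n.+1%:R); first by rewrite -natr1; field; lra.
move: h; rewrite natr_binS -[n.+1%:R]natr1 -[a.+1%:R]natr1 => h.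
have nz : n%:R + 1 != 0 :> F by rewrite natr1 pnatr_eq0.
apply: (mulfI nz); transitivity ((a%:R - n%:R) * 'C(a, n)%:R : F); first by lra.
by field; lra.
Qed.

(** This lemma and the next compare coefficients in E^(r+1) = E^r + X E^r O + x X E^(r+2); the last
    term is absent at x^0. *)
Lemma ucoefS0 r m : ucoef r.+1 m.+1 0 = ucoef r m.+1 0 + vcoef r m 0.
Proof.
rewrite /ucoef /vcoef !bin0 !add0n !addSn !addnS natr_binS.
have [k -> ->] := bin_param (m + r).+1 r.
have := ler0n F m; have := ler0n F r.
rewrite -!natr1 natrD => ? ?; field; lra.
Qed.

Lemma ucoefSS r m n :
  ucoef r.+1 m.+1 n.+1 = ucoef r m.+1 n.+1 + vcoef r m n.+1 + ucoef r.+2 m n.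
Proof.
rewrite /ucoef /vcoef (_ : (2 * m.+1 + r.+1).-1 = (2 * m + r).+2)%N; last by lia.
rewrite (_ : (2 * m.+1 + r).-1 = (2 * m + r).+1)%N; last by lia.
rewrite (_ : (2 * m + r.+2).-1 = (2 * m + r).+1)%N; last by lia.
rewrite !addSn !addnS natr_binS (natr_binS (2 * m + r).+1).
have [k -> ->] := bin_param (m + r).+1 (n + r).+1.
have [l -> ->] := bin_param (2 * m + r).+1 n.
have := ler0n F m; have := ler0n F r; have := ler0n F n.
rewrite -!natr1 !natrD => ? ? ?; field; lra.
Qed.

(** Likewise for E^r O = E^(r+1) + x X E^(r+1) O; here Pascal's rule suffices. *)
Lemma vcoefS0 r m : vcoef r m.+1 0 = ucoef r.+1 m.+1 0.
Proof.
rewrite /ucoef /vcoef !bin0 !add0n !addSn !addnS -(natr1 r).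
by ring.
Qed.

Lemma vcoefSS r m n :
  vcoef r m.+1 n.+1 = ucoef r.+1 m.+1 n.+1 + vcoef r.+1 m n.
Proof.
rewrite /ucoef /vcoef (_ : (2 * m.+1 + r.+1).-1 = (2 * m + r).+2)%N; last by lia.
rewrite (_ : (2 * m.+1 + r) = (2 * m + r).+2)%N; last by lia.
rewrite !addSn !addnS (natr_binS (2 * m + r).+3) (natr_binS (2 * m + r).+2) -(natr1 r).
by ring.
Qed.

Lemma ucoef_big r m n : (m < n)%N -> ucoef r m n = 0.
Proof. by move=> mn; rewrite /ucoef bin_small ?ltn_add2r// !(mulr0, mul0r). Qed.

Lemma vcoef_big r m n : (m < n)%N -> vcoef r m n = 0.
Proof.
by move=> mn; rewrite /vcoef bin_small ?ltnS ?ltn_add2r// !(mulr0, mul0r).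
Qed.

(** Specialization to x = 2, the number of colours. By [ucoef_big] and [vcoef_big], no term with n >
    m is lost. *)
Definition usum (r m : nat) : F := \sum_(n < m.+1) 2 ^+ n * ucoef r m n.
Definition vsum (r m : nat) : F := \sum_(n < m.+1) 2 ^+ n * vcoef r m n.

Lemma vsum_widen r m : vsum r m = \sum_(n < m.+2) 2 ^+ n * vcoef r m n.
Proof. by rewrite big_ord_recr/= vcoef_big// mulr0 addr0. Qed.

Lemma usumS r m : usum r.+1 m.+1 = usum r m.+1 + vsum r m + 2 * usum r.+2 m.
Proof.
rewrite vsum_widen /usum !(big_ord_recl m.+1) ucoefS0/=.
under eq_bigr do rewrite ucoefSS !mulrDr.
rewrite !big_split/= mulr_sumr expr0 !mul1r.
under [\sum_(i < m.+1) 2 * _]eq_bigr do rewrite mulrA -exprS.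
by ring.
Qed.

Lemma vsumS r m : vsum r m.+1 = usum r.+1 m.+1 + 2 * vsum r.+1 m.
Proof.
rewrite /vsum /usum !(big_ord_recl m.+1) vcoefS0/=.
under eq_bigr do rewrite vcoefSS !mulrDr.
rewrite !big_split/= mulr_sumr.
under [\sum_(i < m.+1) 2 * _]eq_bigr do rewrite mulrA -exprS.
by rewrite addrA.
Qed.

Lemma usum0S m : usum 0 m.+1 = 0.
Proof. by rewrite /usum big1// => n _; rewrite /ucoef mul0r mul0r mul0r mulr0. Qed.

Lemma usumS0 r : usum r.+1 0 = 1.
Proof.
by rewrite /usum big_ord1 /ucoef !add0n binn bin0 expr0 !mulr1 mul1r divff ?pnatr_eq0.
Qed.

Lemma vsum0 r : vsum r 0 = 1.
Proof.
rewrite /vsum big_ord1 /vcoef !add0n binn !bin0 expr0 !mulr1 mul1r natr1.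
by rewrite mulVf ?pnatr_eq0.
Qed.

(** Congruence modulo X^(m+1) is compatible with products; it is needed because the system for E and
    O is only assumed in low degrees. *)
Lemma coef_mul_eq (s p q : {poly F}) (m : nat) :
  (forall i, (i <= m)%N -> p`_i = q`_i) ->
  forall i, (i <= m)%N -> (s * p)`_i = (s * q)`_i.
Proof.
move=> pq i im; rewrite !coefM; apply: eq_bigr => j _; rewrite pq//.
exact: leq_trans (leq_subr _ _) im.
Qed.

(* The nonlinear system for E and O, multiplied by E^r, becomes linear in the
   family of all E^r and E^r O, hence determines their coefficients. *)
Lemma coef_powers (E O : {poly F}) (m : nat) :
  (forall i, (i <= m)%N ->
    E`_i = (1 + 'X * O + 2%:P * ('X * (E * E)))`_i) ->
  (forall i, (i < m)%N -> O`_i = (E + 2%:P * ('X * (E * O)))`_i) ->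
  forall i,
  ((i <= m)%N -> forall r, (E ^+ r.+1)`_i = usum r.+1 i) /\
  ((i < m)%N -> forall r, (E ^+ r * O)`_i = vsum r i).
Proof.
move=> hE hO.
have EE i (im : (i <= m)%N) r : (E ^+ r.+1)`_i =
    (E ^+ r)`_i + ('X * (E ^+ r * O))`_i + 2 * ('X * (E ^+ r.+2))`_i.
  rewrite exprSr (coef_mul_eq (E ^+ r) _ _ _ hE i im) -!coefD -coefCM -coefD.
  by congr ((_ : {poly F})`_i); rewrite !exprS; ring.
have OO i (im : (i < m)%N) r : (E ^+ r * O)`_i =
    (E ^+ r.+1)`_i + 2 * ('X * (E ^+ r.+1 * O))`_i.
  case: m hO im {hE EE} => // m' hO im.
  rewrite (coef_mul_eq (E ^+ r) _ _ _ hO i im) -coefCM -coefD.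
  by congr ((_ : {poly F})`_i); rewrite !exprS; ring.
elim=> [|i [IHu IHv]].
  have e0 (m0 : (0 <= m)%N) r : (E ^+ r)`_0 = 1.
    elim: r => [|r IH]; first by rewrite expr0 coef1.
    by rewrite EE// !coefXM/= IH mulr0 !addr0.
  split=> m0 r; first by rewrite e0 ?usumS0.
  by rewrite OO// coefXM/= mulr0 addr0 e0 ?vsum0.
(* In degree [i.+1] the equation refers to E^r in the same degree, whence an inner induction on [r];
   the other terms carry a factor X and have degree [i]. *)
have hu (im : (i < m)%N) r : (E ^+ r)`_i.+1 = usum r i.+1.
  elim: r => [|r IH]; first by rewrite expr0 coef1 usum0S.
  by rewrite EE// !coefXM/= IH IHv// IHu ?usumS// ltnW.
split=> im r; first exact: hu.
by have im' := ltnW im; rewrite (OO _ im) (hu im') coefXM/= (IHv im') vsumS.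
Qed.

Lemma sum_even_ord (N : nat) (g : nat -> nat) :
  (\sum_(k < N | ~~ odd k) g k = \sum_(j < uphalf N) g (2 * j))%N.
Proof.
elim: N => [|N IH]; first by rewrite !big_ord0.
rewrite big_mkcond big_ord_recr/= -big_mkcond IH uphalfE/=.
have [oddN|evenN] := boolP (odd N).
  by rewrite addn0 uphalf_half oddN.
rewrite uphalf_half (negbTE evenN) big_ord_recr/=.
by rewrite mul2n even_halfK.
Qed.

Lemma count_usum (f : nat -> nat) (m : nat) : f 0%N = 1%N ->
  (forall N, (N < 2 * m)%N -> f N.+1 =
     (f N + 2 * \sum_(k < N | ~~ odd k) f k * f (N - k.+1))%N) ->
  (f (2 * m)%N)%:R = usum 1 m.
Proof.
move=> f0 fS.
(* Truncations of the even and odd generating series, holding exactly the values of [f] up to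
   [2 * m]. *)
pose E : {poly F} := \poly_(i < m.+1) (f (2 * i)%N)%:R.
pose O : {poly F} := \poly_(i < m) (f (2 * i).+1%N)%:R.
have cE i : (i <= m)%N -> E`_i = (f (2 * i)%N)%:R by move=> im; rewrite coef_poly ltnS im.
have cO i : (i < m)%N -> O`_i = (f (2 * i).+1%N)%:R by move=> im; rewrite coef_poly im.
have [| |+ _] := coef_powers E O m _ _ m;
  last by move=> /(_ (leqnn m) 0); rewrite expr1 cE.
- case=> [|i] im; first by rewrite cE// !coefD coefCM !coefXM coef1/= f0 mulr0 !addr0.
  rewrite cE// !coefD coefCM !coefXM coef1/= add0r cO// mulnS.
  rewrite (fS (2 * i).+1%N); last by lia.
  rewrite natrD natrM; congr (_ + _ * _).
  (* For N = 2i+1 and k = 2j the remaining length is 2(i-j), so the sum is a coefficient of E *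
     E. *)
  rewrite (sum_even_ord _ (fun k => f k * f ((2 * i).+1 - k.+1))%N).
  rewrite uphalfE/= mul2n doubleK natr_sum coefM.
  apply: eq_bigr => -[j ji] _ /=; rewrite natrM !cE; [|lia..].
  by rewrite (_ : i.*2.+1 - (2 * j).+1 = 2 * (i - j))%N; last by lia.
- move=> i im; rewrite cO// !coefD coefCM !coefXM cE 1?ltnW// fS; last by lia.
  rewrite natrD natrM; congr (_ + _ * _).
  (* For N = 2i the remaining length is odd, which gives a coefficient of X * E * O. *)
  rewrite (sum_even_ord _ (fun k => f k * f ((2 * i) - k.+1))%N).
  rewrite mul2n uphalf_double natr_sum.
  case: i im => [|i] im; first by rewrite big_ord0.
  rewrite coefM; apply: eq_bigr => -[j ji] _ /=; rewrite natrM cE ?cO; [|lia..].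
  by rewrite (_ : i.+1.*2 - (2 * j).+1 = (2 * (i - j)).+1)%N; last by lia.
Qed.

End Closed.

(** * Identification with the hypergeometric value *)

Lemma pochhammerS (R : realType) (x : R) (n : nat) :
  pochhammer x n.+1 = pochhammer x n * (x + n%:R).
Proof. by rewrite /pochhammer big_ord_recr. Qed.

(** Up to sign this is the falling factorial of [a]; the binomial records that it vanishes for n >
    a. *)
Lemma pochhammerN (R : realType) (a n : nat) :
  pochhammer (- a%:R : R) n = (-1) ^+ n * (n`! * 'C(a, n))%:R.
Proof.
elim: n => [|n IH]; first by rewrite /pochhammer big_ord0 expr0 mul1r fact0 bin0.
rewrite pochhammerS IH exprSr factS.
have -> : (n.+1 * n`! * 'C(a, n.+1) = n`! * ((a - n) * 'C(a, n)))%N.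
  by rewrite -mul_bin_left; lia.
have [an|an] := leqP n a; first by rewrite !natrM natrB//; ring.
by rewrite bin_small// !muln0 mulr0n !mulr0 !mul0r.
Qed.

Lemma pochhammer2 (R : realType) (n : nat) : pochhammer (2 : R) n = n.+1`!%:R.
Proof.
elim: n => [|n IH]; first by rewrite /pochhammer big_ord0.
by rewrite pochhammerS IH [in RHS]factS natrM -natrD mulrC.
Qed.

Lemma hyp2F1_usum (R : realType) (d : nat) : (2 <= d)%N ->
  hyp2F1 (2 - 2 * d%:R) (1 - d%:R) 2 2 = usum 1 d.-1 :> R.
Proof.
case: d => // m; rewrite ltnS => m0 /=.
have term n : hyp2F1_term (2 - 2 * m.+1%:R) (1 - m.+1%:R) 2 2 n =
    2 ^+ n * ucoef 1 m n :> R.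
  have -> : 2 - 2 * m.+1%:R = - (2 * m)%:R :> R by rewrite natrM -natr1; ring.
  have -> : 1 - m.+1%:R = - m%:R :> R by rewrite -natr1; ring.
  rewrite /hyp2F1_term /ucoef !pochhammerN pochhammer2 factS !addn1/= !natrM.
  (* This absorption identity turns n! / (n+1)! times 'C(m, n) into the factor 'C(m+1, n+1) / (m+1)
     of [ucoef 1 m n]. *)
  have h : n.+1%:R * 'C(m.+1, n.+1)%:R = m.+1%:R * 'C(m, n)%:R :> R.
    by rewrite -!natrM mul_bin_diag.
  have -> : 'C(m, n)%:R = n.+1%:R * 'C(m.+1, n.+1)%:R / m.+1%:R :> R.
    by rewrite h mulrAC divff ?pnatr_eq0// mul1r.
  have := fact_gt0 n; rewrite -(ltr0n R) => f0.
  have s1 : (-1) ^+ n * (-1) ^+ n = 1 :> R by rewrite -expr2 sqrr_sign.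
  transitivity (((-1) ^+ n * (-1) ^+ n) *
    (2 ^+ n * (1 / m.+1%:R * 'C(m.+1, n.+1)%:R * 'C(2 * m, n)%:R)) : R).
    by field; have := ler0n R m; have := ler0n R n; lra.
  by rewrite s1 [LHS]mul1r.
rewrite /hyp2F1; apply: cvg_lim => //.
(* All terms of index above [m] vanish, so the partial sums are eventually constant. *)
apply: cvg_near_cst; near=> n.
have mn : (m.+1 <= n)%N by near: n; exact: nbhs_infty_ge.
rewrite /series/= /usum -(subnKC mn) /index_iota subn0 iotaD big_cat/=.
rewrite [X in _ + X]big1_seq => [|k]; last first.
  by rewrite mem_iota => /= /andP[mk _]; rewrite term ucoef_big ?mulr0.
rewrite addr0 -(big_mkord xpredT (fun k => 2 ^+ k * ucoef 1 m k)) /index_iota subn0.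
by apply: eq_bigr => k _; rewrite term.
Unshelve. all: by end_near. Qed.

(** * Data sets as coloured diagrams *)

(** Here [T] is determined by [i] and [H] as the rest of the moved indices, and condition (iii)
    becomes stability of [H] under [i]. *)
Lemma comb_dataP d (i : {ffun dirs d -> dirs d}) (H T : {set dirs d}) : reflect
  [/\ forall l, i (i l) = l,
      forall l, (l \in T) = (i l != l) && (l \notin H),
      forall l, (l \in H -> i l != l) /\ (i l \in H) = (l \in H),
      forall l, i l != l -> parity_odd l != parity_odd (i l)
    & noncrossing i]
  ((i, H, T) \in comb_data d).
Proof.
rewrite inE; apply: (iffP and5P) => [[/forallP ii dHT /forallP HT /forallP odd_i
    /andP[nc /forallP same]]|[ii iT iH odd_i nc]].
  have HTN l : l \in H -> l \notin T by move/(disjointFr dHT) ->.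
  have HN l : l \in H -> i l != l by move=> lH; rewrite -(eqP (HT l)) lH.
  have iiE l : i (i l) = l := eqP (ii l).
  have closed l : l \in H -> i l \in H.
    by move=> lH; have := same l; rewrite (HN l lH) lH (negbTE (HTN l lH)) orbF.
  split=> // l.
  - rewrite -(eqP (HT l)); have [lH|//] := boolP (l \in H).
    by rewrite (negbTE (HTN l lH)).
    by rewrite andbT.
  - split; first exact: HN.
    by apply/idP/idP => [/closed|/closed//]; rewrite iiE.
  - exact/implyP/odd_i.
split; rewrite ?nc.
- by apply/forallP => l; rewrite ii.
- rewrite disjoint_subset; apply/fintype.subsetP => l lH.
  by rewrite inE iT lH andbF.
- apply/forallP => l; rewrite iT; have [lH|_] := boolP (l \in H).
    by rewrite (iH l).1.
  by rewrite andbT.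
- by apply/forallP => l; apply/implyP/odd_i.
- apply/forallP => l; apply/implyP => il; rewrite !iT (iH l).2 ii [l == _]eq_sym il/=.
  by case: (l \in H).
Qed.

Lemma card_comb_data d :
  #|comb_data d| =
  #|diagrams_in (K := (Zp_trunc (2 * d - 2)).+2) 0 (Zp_trunc (2 * d - 2)).+2|.
Proof.
set K := (Zp_trunc (2 * d - 2)).+2.
(* Membership in [H] serves as the colour; dropping [T] loses nothing. *)
pose phi (D : comb_triple d) : {ffun 'I_K -> 'I_K * bool} :=
  [ffun l : 'I_K => (D.1.1 l : 'I_K, l \in D.1.2)].
have phi_inj : {in comb_data d &, injective phi}.
  move=> [[i H] T] [[i' H'] T'] /comb_dataP[_ iT _ _ _] /comb_dataP[_ iT' _ _ _] e.
  have el l : (i l, l \in H) = (i' l, l \in H') by have /ffunP/(_ l) := e; rewrite !ffunE.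
  have ei : i = i' by apply/ffunP => l; case: (el l).
  have eH : H = H' by apply/setP => l; case: (el l).
  by congr (_, _, _) => //; apply/setP => l; rewrite iT iT' ei eH.
rewrite -(card_in_imset phi_inj); congr #|pred_of_set _|; apply/setP => f.
apply/imsetP/diagrams_inP => [[[[i H] T] /comb_dataP[ii iT iH odd_i nc] ->]|[cf _]].
  split; last by move=> l; rewrite ltn0/= leqNgt ltn_ord.
  apply/chord_diagramP; split=> [l|l|l|l q]; rewrite !ffunE/=.
  - by rewrite ii (iH l).2.
  - by move=> il; apply/negbTE/negP => /(iH l).1; rewrite il eqxx.
  - exact: odd_i.
  - move=> lq ql; have /forallP/(_ l)/forallP/(_ q) := nc.
    by rewrite /dir_val lq ql/= -leqNgt.
have /chord_diagramP[h1 h2 h3 h4] := cf.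
pose i : {ffun dirs d -> dirs d} := [ffun l : 'I_K => (f l).1].
pose H : {set dirs d} := [set l : 'I_K | (f l).2]%SET.
pose T : {set dirs d} := [set l : 'I_K | ((f l).1 != l) && ~~ (f l).2]%SET.
exists (i, H, T).
  apply/comb_dataP; split.
  - by move=> l; rewrite !ffunE h1.
  - by move=> l; rewrite !inE ffunE.
  - move=> l; rewrite !inE !ffunE h1; split=> // fl.
    by apply/eqP => /h2; rewrite fl.
  - by move=> l; rewrite ffunE; apply: h3.
  - apply/forallP => l; apply/forallP => q; rewrite !ffunE.
    by apply/and3P => -[lq ql]; rewrite /dir_val ltnNge h4.
by apply/ffunP => l; rewrite !ffunE inE; case: (f l).
Qed.

Lemma card_comb_data_hyp2F1 (R : realType) (d : nat) : (2 <= d)%N ->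
  #|comb_data d|%:R = hyp2F1 (2 - 2 * d%:R) (1 - d%:R) 2 2 :> R.
Proof.
(* The carrier of [dirs d] has the intended size because 2d-2 is at least 2. *)
move=> d2; have KE : (Zp_trunc (2 * d - 2)).+2 = (2 * d.-1)%N.
  by rewrite /Zp_trunc; lia.
rewrite hyp2F1_usum// card_comb_data.
pose f N := #|diagrams_in (K := (Zp_trunc (2 * d - 2)).+2) 0 N|.
rewrite -[#|_|]/(f _) KE; apply: count_usum; first exact: diagrams_in_nil.
by move=> N; rewrite -KE; apply: card_diagramsS.
Qed.

(** * Classes and data sets correspond *)

(** Pairs are compared through their odd members only; this suffices since a moved even index is the
    partner of an odd one. *)
Lemma comb_data_sub d (i i' : {ffun dirs d -> dirs d}) (H T H' T' : {set dirs d}) :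
  (i, H, T) \in comb_data d -> (i', H', T') \in comb_data d ->
  (forall k j, parity_odd k -> ~~ parity_odd j ->
    k \in H /\ i k = j -> k \in H' /\ i' k = j) ->
  (forall k j, parity_odd k -> ~~ parity_odd j ->
    k \in T /\ i k = j -> k \in T' /\ i' k = j) ->
  forall l, (i l != l -> i' l = i l) /\ (l \in H -> l \in H').
Proof.
move=> /comb_dataP[ii iT iH odd_i _] /comb_dataP[ii' iT' iH' _ _] subH subT.
have odd_case k : parity_odd k -> i k != k ->
    i' k = i k /\ (k \in H -> k \in H').
  move=> ok ik; have oik : ~~ parity_odd (i k).
    by have := odd_i k ik; rewrite ok; case: parity_odd.
  have [kH|kH] := boolP (k \in H); first by case: (subH k (i k)).
  by case: (subT k (i k)) => //; rewrite iT ik kH.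
move=> l; have [il|il] := eqVneq (i l) l.
  by split=> // /(iH l).1; rewrite il eqxx.
have [ol|el] := boolP (parity_odd l).
  by have [? ?] := odd_case _ ol il.
have oil : parity_odd (i l) by have := odd_i l il; rewrite (negbTE el); case: parity_odd.
have [|e1 e2] := odd_case _ oil; first by rewrite ii eq_sym.
rewrite ii in e1; have e3 : i' l = i l by rewrite -{1}e1 ii'.
by split=> // lH; rewrite -(iH' l).2 e3 e2// (iH l).2.
Qed.

Lemma has_data_inj (R : realType) d P (D D' : comb_triple d) :
  has_data (R := R) P D -> has_data (R := R) P D' -> D = D'.
Proof.
case: D D' => [[i H] T] [[i' H'] T'] [cD hH hT] [cD' hH' hT'].
have sub l : (i l != l -> i' l = i l) /\ (l \in H -> l \in H').
  apply: (comb_data_sub _ _ _ _ _ _ _ cD cD') => k j ok ej.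
    by move/(hH k j ok ej)/(hH' k j ok ej).
  by move/(hT k j ok ej)/(hT' k j ok ej).
have sub' l : (i' l != l -> i l = i' l) /\ (l \in H' -> l \in H).
  apply: (comb_data_sub _ _ _ _ _ _ _ cD' cD) => k j ok ej.
    by move/(hH' k j ok ej)/(hH k j ok ej).
  by move/(hT' k j ok ej)/(hT k j ok ej).
have ei : i = i'.
  apply/ffunP => l; have [il|il] := eqVneq (i l) l; last by rewrite (sub l).1.
  by have [il'|il'] := eqVneq (i' l) l; [rewrite il il'|rewrite (sub' l).1].
have eH : H = H' by apply/setP => l; apply/idP/idP; [apply: (sub l).2|apply: (sub' l).2].
congr (_, _, _) => //; apply/setP => l.
have /comb_dataP[_ -> _ _ _] := cD; have /comb_dataP[_ -> _ _ _] := cD'.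
by rewrite ei eH.
Qed.

Lemma card_comb_classes (R : realType) d :
  all_data_realized R d -> comb_classes R d #= `I_#|comb_data d|.
Proof.
move=> real; pose A := [set D | D \in comb_data d].
have -> : comb_classes R d = (@comb_class R d) @` A.
  apply/seteqP; split=> [K [_ [D cD ->]]|K [D cD <-]]; first by exists D.
  by split; [have [P PD] := real _ cD; exists P|exists D].
apply: card_eq_trans (inj_card_eq _) _.
  (* A field realizing [D] also lies in the class of [D'], so it has both data sets and
     [has_data_inj] applies. *)
  move=> D D' /set_mem cD _ eDD'; have [P PD] := real _ cD.
  have : comb_class D P by split; case: PD.
  by rewrite eDD' => -[_]; apply: (has_data_inj R d P); case: PD.
have -> : A = (@enum_val _ (mem (comb_data d))) @` setT.
  apply/seteqP; split=> [D cD|D [k _ <-]]; last exact: enum_valP.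
  by exists (enum_rank_in cD D) => //; apply: enum_rankK_in.
apply: card_eq_trans (inj_card_eq _) _; first by move=> k l _ _; apply: enum_val_inj.
by rewrite card_eq_sym card_II.
Qed.

Theorem theorem4p2 (R : realType) (d : nat) (hd : (2 <= d)%N) :
  (#|comb_data d|%:R : R) = hyp2F1 (2 - 2 * d%:R) (1 - d%:R) 2 2
  /\ (all_data_realized R d ->
      exists c : nat, comb_classes R d #= `I_c /\
        (c%:R : R) = hyp2F1 (2 - 2 * d%:R) (1 - d%:R) 2 2).
Proof.
split=> [|real]; first exact: card_comb_data_hyp2F1.
by exists #|comb_data d|; split; [exact: card_comb_classes|exact: card_comb_data_hyp2F1].
Qed.
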